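(* Assume that the data $x$ has density $f(x|\theta,\psi)$, $\theta\in\mathbb{R}^p$, $\psi\in\mathbb{R}$, that the maximum likelihood estimates (MLEs) $\hat\theta,\hat\psi$ are obtained, that $\hat\psi$ is a function of $\hat\theta$, and that $Y$ (i.e. $\hat\psi$) has density $g_Y(y|\psi)$. Assume in addition that: (a) $|I_x(\theta,\psi)|=|I_x(\psi)|$, i.e. the determinant of the Fisher information matrix depends on the parameters only through $\psi$; (b) there are functions $\phi(\psi)$ and $u(y)$ such that $$\log f(x|\hat\theta,\psi)-\log g_Y(y|\psi)=\log\phi(\psi)+u(y).$$ Then the Minimum Message Length (MML) estimates $\hat\theta_{MML}$ and $\hat\psi_{MML}$ coincide, respectively, with $\hat\theta$ and $\hat\psi_{MU}$ if the prior satisfies $$h(\theta,\psi)\propto\frac{|I_x(\psi)|^{1/2}}{\phi(\psi)}.$$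
   Context: $I_x(\theta,\psi)$ is Fisher's information matrix for $x$ and $|\cdot|$ denotes determinant. The MML (MML87) estimates $(\hat\theta_{MML},\hat\psi_{MML})$ with prior $h(\theta,\psi)$ are the values of $(\theta,\psi)$ maximizing $$\log h(\theta,\psi)+\log f(x|\theta,\psi)-\tfrac12\log|I_x(\theta,\psi)|.$$ In the setting considered, the MLE $\hat\theta=\hat\theta(x)$ of $\theta$ is obtained first from the likelihood, then $\hat\theta$ is substituted for $\theta$ in the likelihood equation for $\psi$, $\frac{\partial}{\partial\psi}\log f(x|\theta,\psi)=0$, which is solved to give $\hat\psi$; this is the sense in which $\hat\psi$ is a function of $\hat\theta$. The statistic $Y$ is $\hat\psi$; its density $g_Y(y|\psi)$ depends only on $\psi$, and the model updated maximum likelihood estimate (MUMLE) $\hat\psi_{MU}$ is the maximum likelihood estimate of $\psi$ based on the model $g_Y(y|\psi)$ for the data $Y$, i.e. the value of $\psi$ maximizing $g_Y(y|\psi)$ at the observed value $y$ of $Y$. *)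

(* Defs.v *)
From HB Require Import structures.
From mathcomp Require Import all_boot all_order all_algebra.
From mathcomp Require Import all_classical all_reals all_analysis.

Set Implicit Arguments.
Unset Strict Implicit.
Unset Printing Implicit Defensive.

Import Order.TTheory GRing.Theory Num.Theory.
Import numFieldNormedType.Exports.

Local Open Scope classical_set_scope.
Local Open Scope ring_scope.

Definition is_argmax (U : Type) (disp : Order.disp_t) (V : porderType disp)
    (A : set U) (F : U -> V) (a : U) : Prop :=
  A a /\ forall b, A b -> (F b <= F a)%O.

(* The parametric model: a sample space X inside T, a reference measure mu,
   parameters (t, s) = (theta, psi) ranging over Theta `*` Psi, and
   f x t s = f(x | theta, psi). *)

Definition is_density_family (R : realType) (d : measure_display)
    (T : measurableType d) (mu : {measure set T -> \bar R}) (X : set T)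
    (p : nat) (Theta : set 'rV[R]_p) (Psi : set R)
    (f : T -> 'rV[R]_p -> R -> R) : Prop :=
  forall t s, Theta t -> Psi s ->
    [/\ measurable_fun X (fun x => f x t s),
        forall x, X x -> 0 <= f x t s
      & (\int[mu]_(x in X) (f x t s)%:E = 1)%E].

(* The real-valued statistic Y has under (theta, psi) the density g(. | psi)
   with respect to nu; g does not depend on theta. *)
Definition statistic_has_density (R : realType) (d : measure_display)
    (T : measurableType d) (mu : {measure set T -> \bar R}) (X : set T)
    (nu : {measure set (measurableTypeR R) -> \bar R})
    (p : nat) (Theta : set 'rV[R]_p) (Psi : set R)
    (f : T -> 'rV[R]_p -> R -> R) (Y : T -> R) (g : R -> R -> R) : Prop :=
  measurable_fun X (Y : T -> measurableTypeR R) /\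
  forall s, Psi s ->
    [/\ measurable_fun [set: measurableTypeR R] (fun y => g y s),
        forall y, 0 <= g y s
      & forall t, Theta t ->
        forall B : set (measurableTypeR R), measurable B ->
        (\int[mu]_(x in X `&` Y @^-1` B) (f x t s)%:E
           = \int[nu]_(y in B) (g y s)%:E)%E].

(* The p + 1 coordinates are theta_1, ..., theta_p, psi, in this order. *)
Definition score (R : realType) (T : Type) (p : nat)
    (f : T -> 'rV[R]_p -> R -> R) (t : 'rV[R]_p) (s : R) (x : T)
    : 'rV[R]_(p + 1) :=
  row_mx (\row_(k < p) 'D_(delta_mx 0 k) (fun t' => ln (f x t' s)) t)
         (const_mx (derive1 (fun s' => ln (f x t s')) s)).

Definition fisher_information (R : realType) (d : measure_display)
    (T : measurableType d) (mu : {measure set T -> \bar R}) (X : set T)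
    (p : nat) (f : T -> 'rV[R]_p -> R -> R) (t : 'rV[R]_p) (s : R)
    : 'M[R]_(p + 1) :=
  \matrix_(i < p + 1, j < p + 1)
    Rintegral mu X (fun x => score f t s x 0 i * score f t s x 0 j * f x t s).

(* The Fisher information exists at (t, s): the partial derivatives of
   ln \o f are genuine and the integrals are finite.  Derivability is asked of f
   and not of ln \o f because ln vanishes on nonpositive arguments; together
   with 0 < f x t s it makes ln \o f derivable along each coordinate. *)
Definition has_fisher_information (R : realType) (d : measure_display)
    (T : measurableType d) (mu : {measure set T -> \bar R}) (X : set T)
    (p : nat) (f : T -> 'rV[R]_p -> R -> R) (t : 'rV[R]_p) (s : R) : Prop :=
  {ae mu, forall x, X x -> 0 < f x t s ->
     (forall k : 'I_p,
        derivable (fun t' : 'rV[R]_p => f x t' s) t (delta_mx 0 k)) /\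
     derivable (fun s' : R => f x t s') s 1} /\
  forall i j : 'I_(p + 1),
    mu.-integrable X
      (fun x => (score f t s x 0 i * score f t s x 0 j * f x t s)%:E).

(* thetahat x maximizes the likelihood in theta whatever the value of psi (so
   it can be computed first, without knowing psi); psihat x is then the maximum
   likelihood estimate of psi, obtained as a root of the likelihood equation
   for psi in which thetahat x is substituted for theta.  In particular
   (thetahat x, psihat x) maximizes the likelihood jointly. *)
Definition is_sequential_MLE (R : realType) (T : Type) (X : set T)
    (p : nat) (Theta : set 'rV[R]_p) (Psi : set R)
    (f : T -> 'rV[R]_p -> R -> R)
    (thetahat : T -> 'rV[R]_p) (psihat : T -> R) : Prop :=
  forall x, X x ->
    [/\ forall s, Psi s -> is_argmax Theta (fun t => f x t s) (thetahat x),
        is_argmax Psi (fun s => f x (thetahat x) s) (psihat x)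
      & is_derive (psihat x) 1 (fun s => ln (f x (thetahat x) s)) 0].

Definition is_MUMLE (R : realType) (Psi : set R) (g : R -> R -> R) (y s : R)
    : Prop :=
  is_argmax Psi (fun s' => g y s') s.

(* The logarithms are extended-real valued, with lne 0 = -oo, so that points
   of zero likelihood are never preferred. *)
Definition MML_objective (R : realType) (d : measure_display)
    (T : measurableType d) (mu : {measure set T -> \bar R}) (X : set T)
    (p : nat) (f : T -> 'rV[R]_p -> R -> R) (h : 'rV[R]_p -> R -> R)
    (x : T) (ts : 'rV[R]_p * R) : \bar R :=
  (lne (h ts.1 ts.2)%:E + lne (f x ts.1 ts.2)%:E
   - (2^-1)%:E * lne (\det (fisher_information mu X f ts.1 ts.2))%:E)%E.

Definition is_MML (R : realType) (d : measure_display)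
    (T : measurableType d) (mu : {measure set T -> \bar R}) (X : set T)
    (p : nat) (Theta : set 'rV[R]_p) (Psi : set R)
    (f : T -> 'rV[R]_p -> R -> R) (h : 'rV[R]_p -> R -> R)
    (x : T) (t : 'rV[R]_p) (s : R) : Prop :=
  is_argmax (Theta `*` Psi) (MML_objective mu X f h x) (t, s).

(* Main.v *)
(* Since |I|^{1/2} cancels between the prior and the information term, the MML
   objective is log (c f(x | theta, psi) / phi psi).  It is maximized in theta by
   thetahat whatever psi is, and along theta = thetahat it equals
   log (c e^{u y} g_Y(y | psi)) by (b), a multiple of g_Y free of psi. *)

Require Import Defs.
From HB Require Import structures.
From mathcomp Require Import all_boot all_order all_algebra.
From mathcomp Require Import all_classical all_reals all_analysis.

Set Implicit Arguments.
Unset Strict Implicit.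
Unset Printing Implicit Defensive.

Import Order.TTheory GRing.Theory Num.Theory.
Import numFieldNormedType.Exports.

Local Open Scope classical_set_scope.
Local Open Scope ring_scope.

Lemma lee_lne_EFin (R : realType) (a b : R) : 0 <= a -> 0 <= b ->
  (lne a%:E <= lne b%:E)%E = (a <= b).
Proof.
by move=> a0 b0; rewrite lee_lne ?lee_fin// in_itv/= lee_fin leey andbT.
Qed.

(** For [b = 0] both sides are [-oo], because [lne a%:E] is finite. This allows a likelihood that
    may vanish to be split off as a factor. *)
Lemma lne_EFinM (R : realType) (a b : R) : 0 < a -> 0 <= b ->
  lne (a * b)%:E = (lne a%:E + lne b%:E)%E.
Proof.
move=> a0; rewrite le_eqVlt => /predU1P[<-|b0].
  by rewrite mulr0 (@le0_lneNy _ 0%:E)// lne_EFin.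
by rewrite EFinM lneM// in_itv/= lte_fin leey andbT.
Qed.

Lemma ln_sqrt (R : realType) (a : R) : 0 < a -> ln (Num.sqrt a) = 2^-1 * ln a.
Proof. by move=> a0; rewrite -powR12_sqrt ?ltW// ln_powR. Qed.

(** A finite difference excludes zeros: [a = 0] makes it [-oo], even when [b = 0] since [-oo + +oo]
    is [-oo], while [b = 0 < a] makes it [+oo]. Both logarithms are then real and can be
    exponentiated. *)
Lemma lneB_fin (R : realType) (a b k : R) : 0 <= a -> 0 <= b ->
  (lne a%:E - lne b%:E = k%:E)%E -> a = expR k * b.
Proof.
rewrite le_eqVlt => /predU1P[<-|a0] b0; first by rewrite le0_lneNy.
move: b0; rewrite le_eqVlt => /predU1P[<-|b0].
  by rewrite (@le0_lneNy _ 0%:E)// lne_EFin.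
rewrite !lne_EFin// -EFinB => -[<-].
by rewrite expRD expRN !lnK// mulfVK// gt_eqF.
Qed.

Lemma MML_objectiveE (R : realType) (d : measure_display)
    (T : measurableType d) (mu : {measure set T -> \bar R}) (X : set T)
    (p : nat) (f : T -> 'rV[R]_p -> R -> R) (h : 'rV[R]_p -> R -> R)
    (x : T) (t : 'rV[R]_p) (s D q c : R) :
  0 < D -> 0 < q -> 0 < c -> 0 <= f x t s ->
  \det (fisher_information mu X f t s) = D ->
  h t s = c * (Num.sqrt D / q) ->
  MML_objective mu X f h x (t, s) = lne (c / q * f x t s)%:E.
Proof.
move=> D0 q0 c0 f0 detE hE; rewrite /MML_objective [(t, s).1]/= [(t, s).2]/=.
rewrite detE hE mulrCA.
have cq0 : 0 < c / q by rewrite divr_gt0.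
have sD0 : 0 < Num.sqrt D by rewrite sqrtr_gt0.
(* Only [f x t s] may be zero, so its logarithm stays extended-real; the other terms are real, and
   [ln (Num.sqrt D)] cancels half of [ln D]. *)
rewrite mulrC (@lne_EFinM _ (c / q) (f x t s))// addrAC.
rewrite (lne_EFin (mulr_gt0 cq0 sD0)) (lne_EFin cq0) (lne_EFin D0).
by rewrite -EFinM -EFinB (lnM cq0 sD0) ln_sqrt// addrK.
Qed.

Theorem proposition3p2 (R : realType) (d : measure_display)
    (T : measurableType d)
    (mu : {sigma_finite_measure set T -> \bar R})
    (nu : {sigma_finite_measure set (measurableTypeR R) -> \bar R})
    (X : set T) (p : nat) (Theta : set 'rV[R]_p) (Psi : set R)
    (f : T -> 'rV[R]_p -> R -> R)
    (thetahat : T -> 'rV[R]_p) (psihat : T -> R)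
    (g : R -> R -> R)
    (detI : R -> R) (phi : R -> R) (u : R -> R)
    (h : 'rV[R]_p -> R -> R) (c : R) :
  measurable X -> open Theta -> open Psi ->
  is_density_family mu X Theta Psi f ->
  is_sequential_MLE X Theta Psi f thetahat psihat ->
  statistic_has_density mu X nu Theta Psi f psihat g ->
  (forall t s, Theta t -> Psi s -> has_fisher_information mu X f t s) ->
  (* (a), the information matrix being nonsingular *)
  (forall s, Psi s -> 0 < detI s) ->
  (forall t s, Theta t -> Psi s ->
     \det (fisher_information mu X f t s) = detI s) ->
  (* (b); with lne 0 = -oo, both densities are in particular positive *)
  (forall s, Psi s -> 0 < phi s) ->
  (forall x s, X x -> Psi s ->
     (lne (f x (thetahat x) s)%:E - lne (g (psihat x) s)%:E
        = (ln (phi s) + u (psihat x))%:E)%E) ->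
  (* the (possibly improper) prior *)
  0 < c ->
  (forall t s, Theta t -> Psi s -> h t s = c * (Num.sqrt (detI s) / phi s)) ->
  forall x, X x ->
    [/\ forall s, is_MUMLE Psi g (psihat x) s ->
          is_MML mu X Theta Psi f h x (thetahat x) s,
        forall t s, is_MML mu X Theta Psi f h x t s ->
          is_argmax Theta (fun t' => f x t' s) t /\
          is_MUMLE Psi g (psihat x) s
      & (forall t s, Psi s -> is_argmax Theta (fun t' => f x t' s) t ->
           t = thetahat x) ->
        forall t s, is_MML mu X Theta Psi f h x t s <->
          t = thetahat x /\ is_MUMLE Psi g (psihat x) s].
Proof.
move=> _ _ _ dens mle [_ statd] _ detI0 detE phi0 bE c0 hE x Xx.
have [that psimax _] := mle _ Xx.
have psihatP : Psi (psihat x) by case: psimax.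
have thatP : Theta (thetahat x) by case: (that _ psihatP).
have f0 t s : Theta t -> Psi s -> 0 <= f x t s.
  by move=> Tt Ps; have [_ + _] := dens _ _ Tt Ps; exact.
have g0 s : Psi s -> 0 <= g (psihat x) s by move=> /statd[].
have cphi0 s : Psi s -> 0 < c / phi s by move=> Ps; rewrite divr_gt0// phi0.
have objE t s : Theta t -> Psi s ->
    MML_objective mu X f h x (t, s) = lne (c / phi s * f x t s)%:E.
  move=> Tt Ps.
  exact: MML_objectiveE (detI0 _ Ps) (phi0 _ Ps) c0 (f0 _ _ Tt Ps)
    (detE _ _ Tt Ps) (hE _ _ Tt Ps).
have le_obj t s t' s' : Theta t -> Psi s -> Theta t' -> Psi s' ->
    (MML_objective mu X f h x (t, s) <= MML_objective mu X f h x (t', s'))%E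
      = (c / phi s * f x t s <= c / phi s' * f x t' s').
  by move=> *; rewrite !objE// lee_lne_EFin// mulr_ge0 ?f0// ltW// cphi0.
(* By (b), [f x (thetahat x) s] is [phi s * expR (u (psihat x))] times [g (psihat x) s]; the prior's
   [c / phi s] removes [phi s] and leaves a factor free of [s]. *)
pose K := c * expR (u (psihat x)).
have K0 : 0 < K by rewrite mulr_gt0// expR_gt0.
have fhatE s : Psi s -> c / phi s * f x (thetahat x) s = K * g (psihat x) s.
  move=> Ps; rewrite (lneB_fin (f0 _ _ thatP Ps) (g0 _ Ps) (bE _ _ Xx Ps)).
  by rewrite expRD lnK ?posrE ?phi0// !mulrA divfK// gt_eqF ?phi0.
have le_fhat t s : Theta t -> Psi s ->
    c / phi s * f x t s <= c / phi s * f x (thetahat x) s.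
  by move=> Tt Ps; rewrite ler_pM2l ?cphi0//; case: (that _ Ps) => _; exact.
have MU_MML s : is_MUMLE Psi g (psihat x) s ->
    is_MML mu X Theta Psi f h x (thetahat x) s.
  move=> [Ps gmax]; split=> // -[t' s'] [/= Tt' Ps'].
  (* From [(t', s')] pass to [(thetahat x, s')], then compare values of [g] after cancelling [K]. *)
  rewrite le_obj// (le_trans (le_fhat _ _ Tt' Ps'))// !fhatE// ler_pM2l//.
  exact: gmax.
have MML_MU t s : is_MML mu X Theta Psi f h x t s ->
    is_argmax Theta (fun t' => f x t' s) t /\ is_MUMLE Psi g (psihat x) s.
  move=> [[/= Tt Ps] objmax]; split; split=> //.
    (* With [s] fixed, the factor [c / phi s] is common to both sides. *)
    move=> t' Tt'; have := objmax (t', s) (conj Tt' Ps).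
    by rewrite le_obj// ler_pM2l ?cphi0.
  (* The value at [(thetahat x, s')] is at most that at [(t, s)], hence at most that at
     [(thetahat x, s)], even if [t] differs from [thetahat x]. *)
  move=> s' Ps'; have := objmax (thetahat x, s') (conj thatP Ps').
  rewrite le_obj// => /le_trans/(_ (le_fhat _ _ Tt Ps)).
  by rewrite !fhatE// ler_pM2l.
(* Without uniqueness, [t] is only known to be some maximizer of the likelihood at [s]; uniqueness
   identifies it with [thetahat x]. *)
split=> // uniq_that t s; split=> [MMLts|[->]]; last exact: MU_MML.
have [tmax smax] := MML_MU _ _ MMLts.
by split=> //; apply: (uniq_that _ s) => //; case: smax.
Qed.
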